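(* Let $\bar d=(d_j)_{j\ge 0}$ be integers with $d_0=1$ and $d_j\ge 2$ for $j\ge 1$, and let $\bar p=(p_j)_{j\ge 1}$ with $p_j\in(0,1]$. For every $\Omega\in\{c_0,\ c,\ l^\alpha,\ \alpha>1\}$ (with $\alpha$ real), the residual spectrum $\sigma_r(\Omega,\bar d,\bar p)$ is empty.
   Context: $\mathbb{Z}_+=\{0,1,2,\dots\}$. Put $q_j=d_0d_1\cdots d_j$ for $j\ge 0$. Every $n\in\mathbb{Z}_+$ has a unique expansion $n=\sum_{j\ge1}a_j(n)q_{j-1}$ with digits $a_j(n)\in\{0,\dots,d_j-1\}$, only finitely many nonzero. Put $\zeta_n=\min\{j\ge1: a_j(n)\ne d_j-1\}$. Let $S=[s(n,m)]_{n,m\ge0}$ be the stochastic matrix with entries: $s(n,n+1)=\prod_{j=1}^{\zeta_n}p_j$; $s(n,n)=1-p_1$; if $\zeta_n\ge2$, for $1\le r\le\zeta_n-1$, $s\big(n,\,n-\sum_{j=1}^r(d_j-1)q_{j-1}\big)=(1-p_{r+1})\prod_{j=1}^rp_j$; and $s(n,m)=0$ otherwise. Column sums of $S$ are at most $1$, and $(Sw)(n)=\sum_m s(n,m)w(m)$ defines a bounded linear operator on each of the complex sequence spaces (indexed by $\mathbb{Z}_+$) $l^\alpha$, $c$ (convergent sequences, sup norm), $c_0$ (sequences tending to $0$, sup norm). The residual spectrum $\sigma_r(\Omega,\bar d,\bar p)$ of $S$ on $\Omega$ is the set of $\lambda\in\mathbb{C}$ such that $S-\lambda I$ is injective on $\Omega$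 and $(S-\lambda I)\Omega$ is not dense in $\Omega$. *)

(* Defs.v *)
From HB Require Import structures.
From mathcomp Require Import all_boot all_order all_algebra.
From mathcomp Require Import all_classical all_reals all_analysis.
From mathcomp Require Import complex.
From mathcomp Require Import zify.

Set Implicit Arguments.
Unset Strict Implicit.
Unset Printing Implicit Defensive.

Import Order.TTheory GRing.Theory Num.Theory.
Import numFieldNormedType.Exports.

Local Open Scope classical_set_scope.
Local Open Scope ring_scope.
Local Open Scope complex_scope.

Definition is_radix (d : nat -> nat) : Prop :=
  d 0%N = 1%N /\ forall j, (1 <= j)%N -> (2 <= d j)%N.

Definition base_prod (d : nat -> nat) (j : nat) : nat :=
  (\prod_(0 <= i < j.+1) d i)%N.

(* Digits are indexed from 1.  This closed form is the unique digit expansion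
   with respect to [base_prod d]: see [digit_lt], [digit_eq0],
   [digit_expansion] and [digit_uniq]. *)
Definition digit (d : nat -> nat) (n j : nat) : nat :=
  (n %/ base_prod d j.-1 %% d j)%N.

(* The least j >= 1 such that digit d n j <> d j - 1 (see [zetaP]).  Searching
   up to j = n.+1 is enough because digit d n n.+1 = 0. *)
Definition zeta (d : nat -> nat) (n : nat) : nat :=
  (find (fun j => digit d n j.+1 != (d j.+1).-1) (iota 0 n.+1)).+1.

(* The big sum has at most one nonzero term, since its inner sums are strictly
   increasing in r; as r >= 1 forces m < n, the three cases are disjoint. *)
Definition smx (R : realType) (d : nat -> nat) (p : nat -> R) (n m : nat) : R :=
  if m == n.+1 then \prod_(1 <= j < (zeta d n).+1) p j
  else if m == n then 1 - p 1%N
  else \sum_(1 <= r < zeta d n |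
             n == (m + \sum_(1 <= j < r.+1) (d j).-1 * base_prod d j.-1)%N)
         (1 - p r.+1) * \prod_(1 <= j < r.+1) p j.

(* Row n of [smx] vanishes beyond column n.+1 (see [smx_eq0]), so the sum over
   all m is this finite one. *)
Definition smx_op (R : realType) (d : nat -> nat) (p : nat -> R)
    (w : nat -> R[i]) (n : nat) : R[i] :=
  \sum_(0 <= m < n.+2) (smx d p n m)%:C * w m.

Definition cmod (R : realType) (z : R[i]) : R := ComplexField.Normc.normc z.

Definition sup_norm (R : realType) (w : nat -> R[i]) : \bar R :=
  ereal_sup [set (cmod (w n))%:E | n in [set: nat]].

Definition lp_norm (R : realType) (alpha : R) (w : nat -> R[i]) : \bar R :=
  Lnorm (@counting nat R) alpha%:E (fun n => (cmod (w n))%:E).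

(* R[i]^o carries the topology of the modulus on R[i]. *)
Definition c_space (R : realType) : set (nat -> R[i]) :=
  [set w | cvgn (w : nat -> R[i]^o)].

Definition c0_space (R : realType) : set (nat -> R[i]) :=
  [set w | (w : nat -> R[i]^o) @ \oo --> (0 : R[i]^o)].

Definition lp_space (R : realType) (alpha : R) : set (nat -> R[i]) :=
  [set w | (lp_norm alpha w < +oo)%E].

Arguments c_space R : clear implicits.
Arguments c0_space R : clear implicits.

Definition dense_in (R : realType) (Omega : set (nat -> R[i]))
    (N : (nat -> R[i]) -> \bar R) (A : set (nat -> R[i])) : Prop :=
  forall v, Omega v -> forall e : R, 0 < e ->
    exists2 w, A w & (N (fun n => (v n - w n)%R) < e%:E)%E.

Definition shift_op (R : realType) (T : (nat -> R[i]) -> nat -> R[i])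
    (lambda : R[i]) (w : nat -> R[i]) (n : nat) : R[i] :=
  T w n - lambda * w n.

Definition residual_spectrum (R : realType) (Omega : set (nat -> R[i]))
    (N : (nat -> R[i]) -> \bar R) (T : (nat -> R[i]) -> nat -> R[i]) :
    set R[i] :=
  [set lambda | set_inj Omega (shift_op T lambda) /\
                ~ dense_in Omega N (shift_op T lambda @` Omega)].

Lemma base_prod0 d : is_radix d -> base_prod d 0 = 1%N.
Proof. by case=> d0 _; rewrite /base_prod big_nat1. Qed.

Lemma base_prodS d j : base_prod d j.+1 = (base_prod d j * d j.+1)%N.
Proof. by rewrite /base_prod big_nat_recr. Qed.

Lemma base_prod_gt d n : is_radix d -> (n < base_prod d n)%N.
Proof.
move=> rd; elim: n => [|n IHn]; first by rewrite base_prod0.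
by rewrite base_prodS; have := rd.2 n.+1 isT; nia.
Qed.

Lemma base_prod_gt0 d n : is_radix d -> (0 < base_prod d n)%N.
Proof. by move=> rd; have := base_prod_gt n rd; lia. Qed.

Lemma digit_lt d n j : is_radix d -> (1 <= j)%N -> (digit d n j < d j)%N.
Proof. by move=> rd /rd.2 dj; rewrite ltn_mod; lia. Qed.

Lemma digit_eq0 d n j : is_radix d -> (n < j)%N -> digit d n j = 0%N.
Proof.
move=> rd; case: j => // j nj; rewrite /digit divn_small ?mod0n//=.
by have := base_prod_gt j rd; lia.
Qed.

Lemma digitE d n j :
  digit d n j.+1 = (n %% base_prod d j.+1 %/ base_prod d j)%N.
Proof. by rewrite /digit modn_divl base_prodS mulnC. Qed.

Lemma digit_expansion d n : is_radix d ->
  n = (\sum_(1 <= j < n.+1) digit d n j * base_prod d j.-1)%N.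
Proof.
move=> rd.
suff trunc k : (\sum_(1 <= j < k.+1) digit d n j * base_prod d j.-1)%N
             = (n %% base_prod d k)%N.
  by rewrite trunc modn_small// base_prod_gt.
elim: k => [|k IHk]; first by rewrite big_geq// base_prod0// modn1.
rewrite big_nat_recr//= IHk digitE addnC.
rewrite [RHS](divn_eq _ (base_prod d k)); congr addn.
by rewrite modn_dvdm// base_prodS dvdn_mulr.
Qed.

Lemma digit_uniq d (a : nat -> nat) k : is_radix d ->
    (forall j, 1 <= j -> a j < d j)%N -> (forall j, k < j -> a j = 0)%N ->
  forall j, (1 <= j)%N ->
  digit d (\sum_(1 <= i < k.+1) a i * base_prod d i.-1)%N j = a j.
Proof.
move=> rd ad a0.
pose A k := (\sum_(1 <= i < k.+1) a i * base_prod d i.-1)%N.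
have AS m : A m.+1 = (A m + a m.+1 * base_prod d m)%N.
  by rewrite /A big_nat_recr.
have A_lt m : (A m < base_prod d m)%N.
  elim: m => [|m IHm]; first by rewrite /A big_geq// base_prod0.
  by rewrite AS base_prodS; have := ad m.+1 isT; nia.
have A_mod m i : (A (m + i) %% base_prod d m)%N = A m.
  elim: i => [|i IHi]; first by rewrite addn0 modn_small.
  rewrite addnS AS -modnDmr.
  have /dvdnP[c ->] : (base_prod d m %| base_prod d (m + i))%N.
    elim: i {IHi} => [|i IHi]; first by rewrite addn0.
    by rewrite addnS base_prodS dvdn_mulr.
  by rewrite mulnA modnMl addn0.
have A_const i : A (k + i)%N = A k.
  elim: i => [|i IHi]; first by rewrite addn0.
  by rewrite addnS AS IHi a0 ?mul0n ?addn0//; lia.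
case=> // j _; rewrite -/(A k) -(A_const j.+1) addnC digitE A_mod AS.
by rewrite divnDMl ?base_prod_gt0// divn_small.
Qed.

Lemma zetaP d n : is_radix d ->
  [/\ (1 <= zeta d n)%N,
      digit d n (zeta d n) <> (d (zeta d n)).-1
    & forall j, (1 <= j < zeta d n)%N -> digit d n j = (d j).-1].
Proof.
move=> rd; rewrite /zeta; set P := fun j : nat => _.
have hasP : has P (iota 0 n.+1).
  apply/hasP; exists n; first by rewrite mem_iota add0n ltnSn.
  by rewrite /P digit_eq0//; have := rd.2 n.+1 isT; lia.
have f_lt : (find P (iota 0 n.+1) < n.+1)%N.
  by rewrite -[ltnRHS](size_iota 0) -has_find.
split=> //; first by have /eqP := nth_find 0%N hasP; rewrite nth_iota.
case=> // j /andP[_ jf]; apply/eqP; apply: contraFT (before_find 0%N jf).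
by rewrite nth_iota//; lia.
Qed.

Lemma smx_eq0 (R : realType) d (p : nat -> R) n m :
  (n.+1 < m)%N -> smx d p n m = 0.
Proof.
move=> nm; rewrite /smx !ifN; [|lia|lia].
by rewrite big_pred0// => r; lia.
Qed.

(* Main.v *)
(* Write e_n for the unit sequences, q_k for [base_prod d k], P_k = p_1 ... p_k,
   and put h_0 = lambda, h_(k+1) = (h_k^(d_k) - (1 - p_(k+1))) / p_(k+1).  The
   range of S - lambda is in fact dense, except on c for lambda = 1, where the
   constant sequence 1 is an eigenvector.

   Restricting the formal eigenvector n |-> prod_j h_j^(a_j(n)) to a block of q_k
   consecutive indices and applying S - lambda leaves only boundary terms.
   Hence, modulo the range, every e_n with n < q_k is a multiple of the corner
   U_k = e_(q_k - 1), one has U_k = h_(k+1)^(d_(k+1) - 1) U_(k+1), and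
   P_(k+1) h_(k+1) U_k = sum_(r > k) (1 - p_(r+1)) P_r U_r.
   - If |h_j| <= 1 for all j, then U_k is congruent to an average of sequences
     c_j U_j with |c_j| <= 1, whose norm tends to 0.
   - If |h_k| > 1 for some k, then |h_j| > 1 for all j >= k, each U_r with r > k is
     a multiple of U_k with coefficient of modulus at most 1, and the last
     congruence expresses a multiple of U_k, bounded away from 0, by a tail of
     the series, whose norm is small.
   So every e_n is in the closure of the range; no duality is needed. *)
Require Import Defs.
From HB Require Import structures.
From mathcomp Require Import all_boot all_order all_algebra.
From mathcomp Require Import all_classical all_reals all_analysis.
From mathcomp Require Import complex.
From mathcomp Require Import zify ring lra.

Set Implicit Arguments.
Unset Strict Implicit.
Unset Printing Implicit Defensive.

Import Order.TTheory GRing.Theory Num.Theory.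
Import numFieldNormedType.Exports.

Local Open Scope classical_set_scope.
Local Open Scope ring_scope.
Local Open Scope complex_scope.

(** * Combinatorics of the carries *)

Lemma base_prod_dvdn d i j : (i <= j)%N -> (base_prod d i %| base_prod d j)%N.
Proof.
move/subnK <-; elim: (j - i)%N => // k IHk.
by rewrite addSn base_prodS dvdn_mulr.
Qed.

Lemma base_prod_inj d : is_radix d -> injective (base_prod d).
Proof.
move=> hd; suff lt i k : (base_prod d i < base_prod d (i + k.+1))%N.
  move=> i j qij; case: (ssrnat.ltngtP i j) => // ij.
    by have := lt i (j - i.+1)%N; rewrite -addSnnS subnKC// qij ltnn.
  by have := lt j (i - j.+1)%N; rewrite -addSnnS subnKC// qij ltnn.
elim: k => [|k IHk]; rewrite addnS base_prodS.
  by rewrite addn0; have := base_prod_gt0 i hd; have := hd.2 i.+1 isT; nia.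
by have := hd.2 (i + k.+1).+1 isT; nia.
Qed.

(** Each term equals q_j - q_(j-1), so the sum telescopes. A fall with parameter [r] from [n]
    therefore lands on n + 1 - q_r. *)
Lemma sum_full_digits d r : is_radix d ->
  (\sum_(1 <= j < r.+1) (d j).-1 * base_prod d j.-1)%N = (base_prod d r).-1.
Proof.
move=> hd; elim: r => [|r IHr]; first by rewrite big_geq// base_prod0.
rewrite big_nat_recr//= IHr base_prodS.
by have := base_prod_gt0 r hd; have := hd.2 r.+1 isT; nia.
Qed.

(** Write n + 1 = (x + 1) q_r. Then digit r + 1 of [n] is x mod d_(r+1), and it is full exactly when
    d_(r+1) divides x + 1. *)
Lemma dvdn_base_prodS d n r : is_radix d -> (base_prod d r %| n.+1)%N ->
  (base_prod d r.+1 %| n.+1)%N = (digit d n r.+1 == (d r.+1).-1).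
Proof.
move=> hd; have q0 := base_prod_gt0 r hd; have d2 := hd.2 r.+1 isT.
case/dvdnP=> -[//|x] nx; rewrite base_prodS nx [(x.+1 * _)%N]mulnC dvdn_pmul2l//.
have -> : n = (x * base_prod d r + (base_prod d r).-1)%N by lia.
rewrite /digit /= divnMDl// divn_small ?addn0; last by lia.
rewrite /dvdn -addn1 -modnDml.
have := ltn_pmod x (ltnW d2); set y := (x %% _)%N => yd.
have [->|yne] := eqVneq y (d r.+1).-1.
  by rewrite addn1 prednK ?modnn//; lia.
by rewrite modn_small; lia.
Qed.

(** By induction on the preceding lemma, q_r divides n + 1 exactly when the first [r] digits of [n]
    are full. From here on [zeta] is handled through divisibility. *)
Lemma ltn_zeta d n r : is_radix d ->
  (r < zeta d n)%N = (base_prod d r %| n.+1)%N.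
Proof.
move=> hd; have [z0 zne zfull] := zetaP n hd.
have full k : (k < zeta d n)%N -> (base_prod d k %| n.+1)%N.
  elim: k => [|k IHk] kz; first by rewrite base_prod0.
  by rewrite dvdn_base_prodS ?IHk ?zfull//; lia.
have [/full->//|zr] := ltnP r (zeta d n).
apply/esym/negbTE/negP => /(dvdn_trans (base_prod_dvdn d zr)) qz.
case: (zeta d n) z0 zne full qz {zfull zr} => // z _ zne full.
by rewrite dvdn_base_prodS ?full// => /eqP.
Qed.

Lemma zetaE d n k : is_radix d -> (base_prod d k %| n.+1)%N ->
  ~~ (base_prod d k.+1 %| n.+1)%N -> zeta d n = k.+1.
Proof. by move=> hd; rewrite -!ltn_zeta//; lia. Qed.

Lemma zeta_le d n : is_radix d -> (zeta d n <= n.+1)%N.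
Proof.
move=> hd; rewrite leqNgt ltn_zeta//; apply/negP => /dvdn_leq-/(_ isT).
by have := base_prod_gt n.+1 hd; lia.
Qed.

(** * Jump probabilities and the matrix entries *)

Definition partial_prod (R : realType) (p : nat -> R) (k : nat) : R :=
  \prod_(1 <= j < k.+1) p j.

(** The probability of [r] successes followed by a failure. For r = 0 it is the diagonal entry 1 -
    p_1: staying put counts as a fall to n + 1 - q_0. *)
Definition fall_prob (R : realType) (p : nat -> R) (r : nat) : R :=
  (1 - p r.+1) * partial_prod p r.

Section partial_prod.
Context (R : realType) (p : nat -> R).
Hypothesis hp : forall j : nat, (1 <= j)%N -> 0 < p j <= 1.

Lemma partial_prod0 : partial_prod p 0 = 1.
Proof. by rewrite /partial_prod big_geq. Qed.

Lemma partial_prodS k : partial_prod p k.+1 = partial_prod p k * p k.+1.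
Proof. by rewrite /partial_prod big_nat_recr. Qed.

Lemma partial_prod_gt0 k : 0 < partial_prod p k.
Proof.
elim: k => [|k IHk]; first by rewrite partial_prod0.
by rewrite partial_prodS mulr_gt0//; case/andP: (hp (ltn0Sn k)).
Qed.

Lemma fall_probE r : fall_prob p r = partial_prod p r - partial_prod p r.+1.
Proof. by rewrite /fall_prob partial_prodS mulrBl mul1r mulrC. Qed.

Lemma fall_prob_ge0 r : 0 <= fall_prob p r.
Proof.
by rewrite mulr_ge0 ?(ltW (partial_prod_gt0 _))// subr_ge0; case/andP: (hp (ltn0Sn r)).
Qed.

Lemma sum_fall_prob k l : (k <= l)%N ->
  \sum_(k <= r < l) fall_prob p r = partial_prod p k - partial_prod p l.
Proof.
move=> kl; rewrite (eq_bigr (fun r => - (partial_prod p r.+1 - partial_prod p r))).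
  by rewrite sumrN telescope_sumr// opprB.
by move=> r _; rewrite fall_probE opprB.
Qed.

End partial_prod.

Section smx_entries.
Context (R : realType) (d : nat -> nat) (p : nat -> R).
Hypothesis hd : is_radix d.

(** Given n + 1 = m + q_r, divisibility of [m] by q_r amounts to that of n + 1, that is, to r <
    zeta_n. Stated on [m], the condition suits the computation of columns. *)
Lemma smxE n m : smx d p n m =
  (m == n.+1)%:R * partial_prod p (zeta d n) +
  \sum_(0 <= r < n.+1 | (base_prod d r %| m)%N && (n.+1 == m + base_prod d r)%N)
     fall_prob p r.
Proof.
have q0 r : (0 < base_prod d r)%N by exact: base_prod_gt0.
rewrite /smx; case: eqVneq => [->|mn].
  by rewrite mul1r [\sum_(_ <= _ < _ | _) _]big_pred0 ?addr0// => r; have := q0 r; lia.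
rewrite mul0r add0r.
have -> : \sum_(0 <= r < n.+1 | (base_prod d r %| m)%N && (n.+1 == m + base_prod d r)%N)
     fall_prob p r = \sum_(0 <= r < zeta d n | n.+1 == (m + base_prod d r)%N) fall_prob p r.
  rewrite [RHS](big_nat_widen _ _ n.+1) ?zeta_le//; apply: eq_bigl => r.
  rewrite andbC ltn_zeta//; case: eqVneq => //= ->.
  by rewrite dvdn_addl.
have [z0 _ _] := zetaP n hd.
rewrite [RHS]big_ltn_cond// base_prod0// addn1 eqSS [in RHS]eq_sym.
have -> : \sum_(1 <= r < zeta d n |
       n == (m + \sum_(1 <= j < r.+1) (d j).-1 * base_prod d j.-1)%N)
     (1 - p r.+1) * \prod_(1 <= j < r.+1) p j =
   \sum_(1 <= r < zeta d n | n.+1 == (m + base_prod d r)%N) fall_prob p r.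
  apply: eq_bigl => r; rewrite sum_full_digits//; have := q0 r; lia.
case: eqVneq => // <-; rewrite /fall_prob partial_prod0 mulr1.
rewrite big_nat_cond big_pred0 ?addr0// => r.
by have := base_prod_gt r hd; lia.
Qed.

(** The falls telescope to 1 - P_zeta, which the upward jump completes to 1. *)
Lemma smx_row_sum n : \sum_(0 <= m < n.+2) smx d p n m = 1.
Proof.
have -> : \sum_(0 <= m < n.+2) smx d p n m =
    \sum_(0 <= m < n.+1) smx d p n m + partial_prod p (zeta d n).
  rewrite big_nat_recr//=; congr (_ + _).
  rewrite smxE eqxx mul1r [\sum_(_ <= _ < _ | _) _]big_pred0 ?addr0// => r.
  by have := base_prod_gt0 r hd; lia.
rewrite (_ : \sum_(0 <= m < n.+1) _ = \sum_(0 <= r < zeta d n) fall_prob p r).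
  by rewrite sum_fall_prob// partial_prod0 subrK.
rewrite (eq_big_nat _ _ (F2 := fun m => \sum_(0 <= r < n.+1 |
    (base_prod d r %| m)%N && (n.+1 == m + base_prod d r)%N) fall_prob p r)); last first.
  by move=> m mn; rewrite smxE ltn_eqF ?mul0r ?add0r.
(* For each [r], only the column m = n + 1 - q_r can contribute. *)
rewrite (exchange_big_dep predT)//= [RHS](big_nat_widen _ _ n.+1) ?zeta_le//.
rewrite [RHS]big_mkcond/=; apply: eq_bigr => r _; rewrite ltn_zeta//.
have q0 := base_prod_gt0 r hd.
case: ifPn => [qn|qn].
  have qle := dvdn_leq (ltn0Sn n) qn.
  rewrite (eq_bigl (fun m => m == n.+1 - base_prod d r)%N) ?big_nat1_eq => [|m].
    by rewrite ifT//; lia.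
  apply/andP/eqP => [[_ /eqP->]|->]; first by rewrite addnK.
  by rewrite subnK// dvdn_subl.
rewrite big_pred0// => m; apply/negbTE; apply: contra qn => /andP[qm /eqP->].
by rewrite dvdn_addl.
Qed.

End smx_entries.

(** * Congruences modulo the range of [S - lambda] *)

(** A constant of its own, to which the linear structure can be attached. *)
Definition shift_smx (R : realType) (d : nat -> nat) (p : nat -> R) (lambda : R[i])
    (w : nat -> R[i]) : nat -> R[i] :=
  shift_op (smx_op d p) lambda w.

Lemma shift_smx_is_linear (R : realType) d (p : nat -> R) (lambda : R[i]) :
  linear (shift_smx d p lambda).
Proof.
move=> a u v; apply/funext => n.
have -> : shift_smx d p lambda (a *: u + v) n =
    \sum_(0 <= m < n.+2) (smx d p n m)%:C * (a * u m + v m) - lambda * (a * u n + v n).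
  by [].
have -> : (a *: shift_smx d p lambda u + shift_smx d p lambda v) n =
    a * (\sum_(0 <= m < n.+2) (smx d p n m)%:C * u m - lambda * u n) +
    (\sum_(0 <= m < n.+2) (smx d p n m)%:C * v m - lambda * v n).
  by [].
under eq_bigr do rewrite mulrDr mulrCA.
by rewrite big_split/= -mulr_sumr; ring.
Qed.

HB.instance Definition _ (R : realType) d (p : nat -> R) (lambda : R[i]) :=
  GRing.isLinear.Build R[i] (nat -> R[i]) (nat -> R[i]) _ (shift_smx d p lambda)
    (shift_smx_is_linear d p lambda).

Section shift_smx_linear.
Context (R : realType) (d : nat -> nat) (p : nat -> R) (lambda : R[i]).
Local Notation L := (shift_smx d p lambda).

Lemma shift_smx0 : L 0 = 0.
Proof. exact: raddf0. Qed.

Lemma shift_smxD u v : L (u + v) = L u + L v.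
Proof. exact: raddfD. Qed.

Lemma shift_smxB u v : L (u - v) = L u - L v.
Proof. exact: raddfB. Qed.

Lemma shift_smxZ a u : L (a *: u) = a *: L u.
Proof. exact: linearZ. Qed.

Lemma shift_smx_sum (r : seq nat) (F : nat -> nat -> R[i]) :
  L (\sum_(i <- r) F i) = \sum_(i <- r) L (F i).
Proof. exact: raddf_sum. Qed.

End shift_smx_linear.

Definition delta (R : realType) (m : nat) : nat -> R[i] := fun n => (n == m)%:R.
Arguments delta {R} m.

Definition finite_supp (R : realType) (w : nat -> R[i]) : Prop :=
  exists K, forall n, (K <= n)%N -> w n = 0.

Section finite_supp.
Context (R : realType).
Implicit Types u v w : nat -> R[i].

Lemma finite_supp0 : finite_supp (0 : nat -> R[i]).
Proof. by exists 0%N. Qed.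

Lemma finite_supp_delta m : finite_supp (delta m : nat -> R[i]).
Proof. by exists m.+1 => n mn; rewrite /delta gtn_eqF. Qed.

Lemma finite_suppZ a w : finite_supp w -> finite_supp (a *: w).
Proof. by move=> [K wK]; exists K => n /wK wn; rewrite fctE wn scaler0. Qed.

Lemma finite_suppD u v : finite_supp u -> finite_supp v -> finite_supp (u + v).
Proof.
move=> [K uK] [L vL]; exists (maxn K L) => n; rewrite geq_max => /andP[/uK un /vL vn].
by rewrite fctE un vn addr0.
Qed.

Lemma finite_suppB u v : finite_supp u -> finite_supp v -> finite_supp (u - v).
Proof. by move=> fu fv; rewrite -scaleN1r; apply/finite_suppD/finite_suppZ. Qed.

Lemma finite_supp_sum (I : Type) (r : seq I) (P : pred I) (F : I -> nat -> R[i]) :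
  (forall i, P i -> finite_supp (F i)) -> finite_supp (\sum_(i <- r | P i) F i).
Proof.
by move=> FP; elim/big_ind: _ => //; [exact: finite_supp0|exact: finite_suppD].
Qed.

End finite_supp.

Section congruence.
Context (R : realType) (d : nat -> nat) (p : nat -> R) (lambda : R[i]).
Local Notation L := (shift_smx d p lambda).
Implicit Types u v w : nat -> R[i].

(** Finitely supported preimages lie in every space considered, so the congruences are derived once
    for all of them. *)
Definition range_eq u v : Prop := exists2 w, finite_supp w & u - v = L w.

Lemma range_eq_refl u : range_eq u u.
Proof. by exists 0; rewrite ?subrr ?shift_smx0//; exact: finite_supp0. Qed.

Lemma range_eq_trans u v w : range_eq u v -> range_eq v w -> range_eq u w.
Proof.
move=> [x fx uv] [y fy vw]; exists (x + y); first exact: finite_suppD.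
by rewrite -(subrKA v) uv vw shift_smxD.
Qed.

Lemma range_eqZ a u v : range_eq u v -> range_eq (a *: u) (a *: v).
Proof.
move=> [x fx uv]; exists (a *: x); first exact: finite_suppZ.
by rewrite -scalerBr uv shift_smxZ.
Qed.

Lemma range_eqD u v u' v' :
  range_eq u v -> range_eq u' v' -> range_eq (u + u') (v + v').
Proof.
move=> [x fx uv] [y fy uv']; exists (x + y); first exact: finite_suppD.
by rewrite opprD addrACA uv uv' shift_smxD.
Qed.

Lemma range_eq_sym u v : range_eq u v -> range_eq v u.
Proof.
move=> [x fx uv]; exists (-1 *: x); first exact: finite_suppZ.
by rewrite shift_smxZ scaleN1r -uv opprB.
Qed.

Lemma range_eq_sum (r : seq nat) (P : pred nat) (F G : nat -> nat -> R[i]) :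
  (forall i, i \in r -> P i -> range_eq (F i) (G i)) ->
  range_eq (\sum_(i <- r | P i) F i) (\sum_(i <- r | P i) G i).
Proof.
move=> FG; rewrite big_seq_cond [X in range_eq _ X]big_seq_cond.
apply: (big_ind2 range_eq) => [||i /andP[ir Pi]]; first exact: range_eq_refl.
  by move=> ? ? ? ?; exact: range_eqD.
exact: FG.
Qed.

End congruence.

(** * Multipliers, blocks and corners *)

Fixpoint multiplier (R : realType) (d : nat -> nat) (p : nat -> R) (lambda : R[i])
    (k : nat) : R[i] :=
  if k is k'.+1 then
    (multiplier d p lambda k' ^+ d k' - (1 - p k)%:C) / (p k)%:C
  else lambda.

(* When [h] is the sequence of multipliers, this is the formal [lambda]-eigenvector
   restricted to the first [base_prod d k] indices and translated by [m]. *)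
Fixpoint lead_block (R : realType) (d : nat -> nat) (h : nat -> R[i]) (k m : nat) :
    nat -> R[i] :=
  if k is k'.+1 then
    \sum_(0 <= a < d k) h k ^+ a *: lead_block d h k' (m + a * base_prod d k')
  else delta m.

Definition corner (R : realType) (d : nat -> nat) (k : nat) : nat -> R[i] :=
  delta (base_prod d k).-1.
Arguments corner {R} d k.

Section blocks.
Context (R : realType) (d : nat -> nat) (p : nat -> R) (lambda : R[i]).
Hypothesis hd : is_radix d.
Hypothesis hp : forall j : nat, (1 <= j)%N -> 0 < p j <= 1.

Local Notation q := (base_prod d).
Local Notation L := (shift_smx d p lambda).
Local Notation P := (partial_prod p).
Local Notation h := (multiplier d p lambda).
Local Notation B := (lead_block d h).
Local Notation "u =~ v" := (range_eq d p lambda u v) (at level 70).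

Lemma finite_supp_block k m : finite_supp (B k m).
Proof.
elim: k m => [|k IHk] m; first exact: finite_supp_delta.
by apply: finite_supp_sum => a _; apply: finite_suppZ.
Qed.

Lemma shift_smx_delta m n : L (delta m) n = (smx d p n m)%:C - lambda * (n == m)%:R.
Proof.
rewrite /shift_smx /shift_op /smx_op; congr (_ - _).
have [mn|mn] := leqP m n.+1; last first.
  rewrite smx_eq0// big_nat big1// => i /andP[_ i_lt].
  by rewrite /delta ltn_eqF ?mulr0//; lia.
rewrite (bigD1_seq m) ?iota_uniq ?mem_index_iota//=.
rewrite /delta eqxx mulr1 big1 ?addr0// => i im.
by rewrite (negbTE im) mulr0.
Qed.

(** The recursion cleared of denominators. The cancellations of boundary terms below all come from
    eliminating [fall_prob p k] through it. *)
Lemma multiplierS k : (P k.+1)%:C * h k.+1 =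
  (P k)%:C * h k ^+ d k - (fall_prob p k)%:C.
Proof.
have pk : (p k.+1)%:C != 0.
  by rewrite (inj_eq (@complexI R)) gt_eqF//; case/andP: (hp (ltn0Sn k)).
have hpk : h k.+1 * (p k.+1)%:C = h k ^+ d k - (1 - p k.+1)%:C by rewrite /= divfK.
by rewrite /fall_prob partial_prodS !rmorphM/= -mulrA [X in _ * X = _]mulrC hpk; ring.
Qed.

Lemma natM_complex (b : nat) (x : R) : (b%:R * x)%:C = b%:R * x%:C.
Proof. by rewrite rmorphM rmorph_nat. Qed.

Arguments multiplier : simpl never.

Lemma fall_sumS k m n :
  \sum_(k <= r < n.+1 | (q r %| m)%N && (n.+1 == m + q r)%N) fall_prob p r =
  ((q k %| m)%N && (n.+1 == m + q k)%N)%:R * fall_prob p k +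
  \sum_(k.+1 <= r < n.+1 | (q r %| m)%N && (n.+1 == m + q r)%N) fall_prob p r.
Proof.
have [kn|nk] := leqP k n.
  by rewrite big_ltn_cond//; case: ifP => _; rewrite (mul1r, mul0r) ?add0r.
rewrite !big_geq//; last by lia.
by rewrite (_ : (_ == _)%N = false) ?andbF ?mul0r ?addr0//; have := base_prod_gt k hd; lia.
Qed.

Lemma fall_sum_ndvd k m n : ~~ (q k %| m)%N ->
  \sum_(k <= r < n.+1 | (q r %| m)%N && (n.+1 == m + q r)%N) fall_prob p r = 0.
Proof.
move=> qm; rewrite big_nat_cond big_pred0// => r.
apply/negbTE; apply: contra qm => /andP[/andP[kr _] /andP[qr _]].
exact: dvdn_trans (base_prod_dvdn d kr) qr.
Qed.

(** Three boundary terms remain: the jump from m - 1 into the block, the falls onto [m] with r >= k,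
    and a term at the last index of the block. By induction, a block of level k + 1 is a weighted
    sum of blocks of level [k], whose boundary terms telescope. *)
Lemma shift_smx_block k m n : (q k %| m)%N ->
  L (B k m) n = (n.+1 == m)%:R * (P (zeta d n))%:C
    + (\sum_(k <= r < n.+1 | (q r %| m)%N && (n.+1 == m + q r)%N) fall_prob p r)%:C
    - (P k)%:C * h k ^+ d k * (n.+1 == m + q k)%N%:R.
Proof.
elim: k m n => [|k IHk] m n qm.
  rewrite /= shift_smx_delta smxE// base_prod0// addn1 eqSS hd.1 expr1.
  by rewrite partial_prod0 mul1r rmorphD rmorphM/= rmorph_nat eq_sym.
have q0 := base_prod_gt0 k hd; have d2 := hd.2 k.+1 isT.
have qkm : (q k %| m)%N by apply: dvdn_trans qm; rewrite base_prodS dvdn_mulr.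
pose f a := h k.+1 ^+ a * (n.+1 == m + a * q k)%N%:R.
(* The sub-block starts at a multiple of q_k that q_(k+1) does not divide. Hence zeta is k + 1 just
   before it and only the fall r = k reaches its start, which leaves a difference of consecutive
   [f]. *)
have later a : (0 < a < d k.+1)%N ->
    h k.+1 ^+ a * L (B k (m + a * q k)) n = - (P k.+1)%:C * (f a.+1 - f a).
  move=> /andP[a0 ad].
  have qm' : (q k %| m + a * q k)%N by rewrite dvdn_addl// dvdn_mull.
  have nqm : ~~ (q k.+1 %| m + a * q k)%N.
    by rewrite dvdn_addr// base_prodS mulnC dvdn_pmul2r// gtnNdvd.
  rewrite IHk// fall_sumS fall_sum_ndvd// addr0 qm'/=.
  have -> : (n.+1 == m + a * q k)%:R * (P (zeta d n))%:C =
      (n.+1 == m + a * q k)%:R * (P k.+1)%:C.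
    by case: eqP => [nE|]; rewrite ?mul0r// (@zetaE d n k)// nE.
  have := multiplierS k; rewrite natM_complex /f exprS mulSn addnCA addnC.
  move: (P k)%:C (P k.+1)%:C (fall_prob p k)%:C (_ ^+ d k) => x y z t xyz.
  have -> : z = x * t - y * h k.+1 by rewrite xyz; ring.
  ring.
have L_block : L (B k.+1 m) n =
    \sum_(0 <= a < d k.+1) h k.+1 ^+ a * L (B k (m + a * q k)) n.
  rewrite [B _ _]/= shift_smx_sum fct_sumE; apply: eq_bigr => a _.
  by rewrite shift_smxZ.
rewrite L_block big_ltn//; last by lia.
rewrite (eq_big_nat _ _ later) -mulr_sumr telescope_sumr; last by lia.
rewrite expr0 mul1r mul0n addn0 IHk// fall_sumS qkm/= rmorphD/= natM_complex.
rewrite /f mul1n expr1 [(d k.+1 * q k)%N]mulnC -base_prodS.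
have := multiplierS k.
move: (P k)%:C (P k.+1)%:C (fall_prob p k)%:C (h k ^+ d k) => x y z t xyz.
have -> : z = x * t - y * h k.+1 by rewrite xyz; ring.
ring.
Qed.

(* For [m] with exactly [k] trailing zero digits the corrections cancel, so that modulo the
   range incrementing the digit in position [k.+1] amounts to a division by [h k.+1]. *)
Lemma delta_pred_range_eq k m : (0 < m)%N -> (q k %| m)%N -> ~~ (q k.+1 %| m)%N ->
  delta m.-1 =~ h k.+1 *: delta (m + q k).-1.
Proof.
move=> m0 qm nqm; exists ((P k.+1)%:C^-1 *: B k m).
  by apply: finite_suppZ; exact: finite_supp_block.
have P0 : (P k.+1)%:C != 0.
  by rewrite (inj_eq (@complexI R)) gt_eqF// partial_prod_gt0.
apply/funext => n; rewrite shift_smxZ.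
have -> : ((P k.+1)%:C^-1 *: L (B k m)) n = (P k.+1)%:C^-1 * L (B k m) n by [].
have -> : (delta m.-1 - h k.+1 *: delta (m + q k).-1) n =
  (n == m.-1)%:R - h k.+1 * (n == (m + q k).-1)%N%:R by [].
rewrite shift_smx_block// fall_sumS fall_sum_ndvd// addr0 qm/= natM_complex.
have -> : (n.+1 == m)%:R * (P (zeta d n))%:C = (n == m.-1)%:R * (P k.+1)%:C.
  rewrite -[in LHS](prednK m0) eqSS; case: eqP => [nE|]; rewrite ?mul0r//.
  by rewrite (@zetaE d n k)// nE prednK.
have <- : (n.+1 == m + q k)%N = (n == (m + q k).-1)%N by lia.
have := multiplierS k.
move: (P k)%:C (P k.+1)%:C P0 (fall_prob p k)%:C (h k ^+ d k) => x y y0 z t xyz.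
have -> : z = x * t - y * h k.+1 by rewrite xyz; ring.
by apply: (mulfI y0); rewrite [in RHS]mulrA mulfV// mul1r; ring.
Qed.

(** For m = 0 no jump enters the block and every q_r divides [m], so all falls survive. The one with
    r = k merges with the term at the last index. *)
Lemma corner_shift_smx k n :
  L (B k 0) n = (\sum_(k.+1 <= r < n.+1 | n.+1 == q r) fall_prob p r)%:C
    - (P k.+1)%:C * h k.+1 * corner d k n.
Proof.
rewrite shift_smx_block// mul0r add0r fall_sumS dvdn0/= !add0n rmorphD/= natM_complex.
have -> : corner d k n = (n.+1 == q k)%:R :> R[i].
  by rewrite /corner /delta; congr (_%:R); have := base_prod_gt0 k hd; lia.
rewrite multiplierS.
rewrite (eq_bigl (fun r => n.+1 == q r)); last by move=> r; rewrite dvdn0.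
ring.
Qed.

(** Digit k + 1 is incremented d_(k+1) - 1 times, which leads from q_k - 1 to q_(k+1) - 1 at the
    cost of one factor h_(k+1) each. *)
Lemma corner_range_eqS k : corner d k =~ h k.+1 ^+ (d k.+1).-1 *: corner d k.+1.
Proof.
have q0 := base_prod_gt0 k hd; have d2 := hd.2 k.+1 isT.
have step a : (a < d k.+1)%N -> corner d k =~ h k.+1 ^+ a *: delta (a.+1 * q k).-1.
  elim: a => [|a IHa] ad.
    by rewrite expr0 scale1r mul1n; exact: range_eq_refl.
  apply: range_eq_trans (IHa (ltnW ad)) _.
  rewrite exprSr -scalerA; apply: range_eqZ.
  rewrite [(a.+2 * _)%N]mulSn addnC; apply: delta_pred_range_eq.
  - by rewrite muln_gt0 q0.
  - by rewrite dvdn_mull.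
  - by rewrite base_prodS mulnC dvdn_pmul2r// gtnNdvd.
by have := step (d k.+1).-1; rewrite prednK ?(ltnW d2)// mulnC -base_prodS; apply; lia.
Qed.

(** With z = zeta_m, the index moves up from [m] to m + q_(z-1). Induction on the distance to q_K
    ends at the corner. *)
Lemma delta_range_eq_corner K m : (m < q K)%N ->
  exists c, delta m =~ c *: corner d K.
Proof.
move: {2}(q K - m)%N (leqnn (q K - m)) => N; elim: N m => [|N IHN] m qN mq; first by lia.
have [->|mne] := eqVneq m (q K).-1.
  by exists 1; rewrite scale1r; exact: range_eq_refl.
have [z0 _ _] := zetaP m hd; set z := zeta d m in z0.
have qz : (q z.-1 %| m.+1)%N by rewrite -ltn_zeta//; rewrite -/z; lia.
have nqz : ~~ (q z.-1.+1 %| m.+1)%N by rewrite -ltn_zeta//; rewrite -/z; lia.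
have zK : (z.-1 <= K)%N.
  rewrite leqNgt; apply/negP => Kz.
  have : (q K %| m.+1)%N by rewrite -ltn_zeta//; rewrite -/z; lia.
  by move/(dvdn_leq (ltn0Sn m)); lia.
(* Both m + 1 and q_K are multiples of q_(z-1), and m + 1 < q_K; so they differ by at least
   q_(z-1). *)
have mqK : (m.+1 + q z.-1 <= q K)%N.
  have q0 := base_prod_gt0 z.-1 hd.
  have [x xE] := dvdnP (base_prod_dvdn d zK); have [y yE] := dvdnP qz.
  have : (y * q z.-1 < x * q z.-1)%N by lia.
  by rewrite ltn_mul2r q0/= xE yE -mulSnr leq_mul2r => ->; rewrite orbT.
have qz0 := base_prod_gt0 z.-1 hd.
have [||c Hc] := IHN (m.+1 + q z.-1).-1; [lia|lia|].
exists (h z.-1.+1 * c); rewrite -scalerA.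
apply: range_eq_trans (range_eqZ _ Hc).
exact: (delta_pred_range_eq (ltn0Sn m)).
Qed.

End blocks.

(** * Approximation by the range *)

Section cmod.
Context (R : realType).
Implicit Types z : R[i].

Lemma cmodM z1 z2 : cmod (z1 * z2) = cmod z1 * cmod z2.
Proof. exact: ComplexField.Normc.normcM. Qed.

Lemma normr_cmod z : `|z| = (cmod z)%:C.
Proof. by []. Qed.

Lemma cmod_ge0 z : 0 <= cmod z.
Proof. by rewrite -lecR -normr_cmod normr_ge0. Qed.

Lemma cmodD z1 z2 : cmod (z1 + z2) <= cmod z1 + cmod z2.
Proof. by rewrite -lecR rmorphD/= -!normr_cmod ler_normD. Qed.

Lemma cmod_real (x : R) : cmod x%:C = `|x|.
Proof. by rewrite /cmod /ComplexField.Normc.normc /= expr0n addr0 sqrtr_sqr. Qed.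

Lemma cmod0 : cmod (0 : R[i]) = 0.
Proof. by rewrite (cmod_real 0) normr0. Qed.

Lemma cmod1 : cmod (1 : R[i]) = 1.
Proof. by rewrite (cmod_real 1) normr1. Qed.

Lemma cmodV z : cmod z^-1 = (cmod z)^-1.
Proof. exact: ComplexField.Normc.normcV. Qed.

Lemma cmodX z n : cmod (z ^+ n) = cmod z ^+ n.
Proof. by elim: n => [|n IHn]; rewrite ?expr0 ?cmod1// !exprS cmodM IHn. Qed.

Lemma cmod_sum (I : Type) (r : seq I) (P : pred I) (F : I -> R[i]) :
  cmod (\sum_(i <- r | P i) F i) <= \sum_(i <- r | P i) cmod (F i).
Proof.
elim/big_rec2: _ => [|i x y _ le]; first by rewrite cmod0.
by apply: le_trans (cmodD _ _) _; rewrite lerD2l.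
Qed.

Lemma cmodB_ge z1 z2 : cmod z1 - cmod z2 <= cmod (z1 - z2).
Proof. by rewrite lerBlDr -{1}(subrK z2 z1) cmodD. Qed.

Lemma cmod_eq0 z : (cmod z == 0) = (z == 0).
Proof. by rewrite -(inj_eq (@complexI R)) -normr_cmod normr_eq0. Qed.

End cmod.

(* The only feature of the spaces that matters: a sequence with small entries and l^1 norm at
   most 1 is small.  It fails in l^1. *)
Definition spreading_norm (R : realType) (N : (nat -> R[i]) -> \bar R) : Prop :=
  forall e : R, 0 < e -> exists2 eta : R, 0 < eta &
    forall x, (forall n, cmod (x n) <= eta) ->
      (forall K, \sum_(0 <= n < K) cmod (x n) <= 1) -> (N x < e%:E)%E.

(** The formal series of the b_r U_r. Since q_r > r, an index with q_r = n + 1 satisfies r <= n, so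
    each entry is a finite sum and no convergence is involved. *)
Definition corner_comb (R : realType) (d : nat -> nat) (b : nat -> R[i]) : nat -> R[i] :=
  fun n => \sum_(0 <= r < n.+1 | n.+1 == base_prod d r) b r.

Section corner_comb.
Context (R : realType) (d : nat -> nat).
Hypothesis hd : is_radix d.
Local Notation q := (base_prod d).
Implicit Type b : nat -> R[i].

Lemma corner_comb_finite b M : (forall r, (M <= r)%N -> b r = 0) ->
  \sum_(0 <= r < M) b r *: corner d r = corner_comb d b.
Proof.
move=> bM; apply/funext => n; rewrite fct_sumE /corner_comb.
have cE r : (b r *: corner d r) n = if n.+1 == q r then b r else 0.
  have -> : (b r *: corner d r) n = b r * (n == (q r).-1)%:R by [].
  have -> : (n == (q r).-1) = (n.+1 == q r) by have := base_prod_gt0 r hd; lia.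
  by case: (n.+1 == q r); rewrite ?mulr1 ?mulr0.
under eq_bigr do rewrite cE.
rewrite -big_mkcond/=.
have cut (K1 K2 : nat) : (K1 <= K2)%N ->
    (forall r, (K1 <= r < K2)%N -> n.+1 == q r -> b r = 0) ->
    \sum_(0 <= r < K2 | n.+1 == q r) b r = \sum_(0 <= r < K1 | n.+1 == q r) b r.
  move=> K12 b0; rewrite (big_cat_nat (n := K1))//= [X in _ + X]big_nat_cond.
  by rewrite [X in _ + X]big1 ?addr0// => r /andP[rK qr]; exact: b0.
have [Mn|nM] := leqP M n.+1.
  by apply/esym/cut => // r /andP[Mr _] _; exact: bM.
by apply: cut; [lia|move=> r ?; have := base_prod_gt r hd; lia].
Qed.

(** The q_r are distinct, so each b_r occurs once as an entry and all other entries vanish. Bounds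
    on the entries and on the l^1 norm thus pass from [b] to the series. *)
Lemma corner_comb_lt N e : spreading_norm N -> 0 < e -> exists2 eta : R, 0 < eta &
  forall b, (forall r, cmod (b r) <= eta) ->
    (forall K, \sum_(0 <= r < K) cmod (b r) <= 1) -> (N (corner_comb d b) < e%:E)%E.
Proof.
move=> sN /sN[eta eta0 small]; exists eta => // b b_eta b1.
apply: small => [n|K].
  have [[r [qr]]|noq] := pselect (exists r, n.+1 = q r).
    rewrite /corner_comb (eq_bigl (fun s => s == r)); last first.
      by move=> s; rewrite qr eq_sym; exact: (inj_eq (base_prod_inj hd)).
    by rewrite big_nat1_eq; case: ifP; rewrite ?cmod0// ltW.
  rewrite /corner_comb big_pred0 ?cmod0 ?ltW// => r.
  by apply/eqP => qr; apply: noq; exists r.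
apply: le_trans (b1 K).
apply: (@le_trans _ _ (\sum_(0 <= n < K) \sum_(0 <= r < K | n.+1 == q r) cmod (b r))).
  rewrite !big_nat; apply: ler_sum => n /andP[_ nK].
  apply: le_trans (cmod_sum _ _ _) _.
  rewrite [leRHS](big_cat_nat (n := n.+1))//= lerDl.
  by apply: sumr_ge0 => r _; exact: cmod_ge0.
rewrite (exchange_big_dep predT)//=; apply: ler_sum => r _.
rewrite (eq_bigl (fun n => n == (q r).-1)); last by move=> n; have := base_prod_gt0 r hd; lia.
by rewrite big_nat1_eq; case: ifP => // _; exact: cmod_ge0.
Qed.

Lemma corner_combD b1 b2 :
  corner_comb d (fun r => b1 r + b2 r) = corner_comb d b1 + corner_comb d b2.
Proof. by apply/funext => n; rewrite /corner_comb big_split. Qed.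

End corner_comb.

Section approximation.
Context (R : realType) (d : nat -> nat) (p : nat -> R) (lambda : R[i]).
Context (N : (nat -> R[i]) -> \bar R).
Local Notation L := (shift_smx d p lambda).
Local Notation "u =~ v" := (range_eq d p lambda u v) (at level 70).
Hypothesis ND : forall u v, (N (u + v)%R <= N u + N v)%E.
Hypothesis NZ : forall a u, (N (a *: u)%R <= (cmod a)%:E * N u)%E.

Definition approximable (v : nat -> R[i]) : Prop :=
  forall e : R, 0 < e -> exists2 w, finite_supp w & (N (v - L w)%R < e%:E)%E.

Lemma approximable_range_eq u v : u =~ v -> approximable v -> approximable u.
Proof.
move=> [w fw uv] av e /av[x fx Nx]; exists (w + x); first exact: finite_suppD.
suff -> : u - L (w + x) = v - L x by [].
by rewrite shift_smxD -uv opprD addrA subKr.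
Qed.

Lemma approximableZ a v : approximable v -> approximable (a *: v).
Proof.
(* Adding 1 avoids a division by zero when a = 0. *)
move=> av e e0; have a1 : 0 < cmod a + 1 by rewrite ltr_wpDl ?cmod_ge0.
have [w fw Nw] := av _ (divr_gt0 e0 a1).
exists (a *: w); first exact: finite_suppZ.
rewrite shift_smxZ -scalerBr; apply: le_lt_trans (NZ _ _) _.
apply: (@le_lt_trans _ _ ((cmod a)%:E * (e / (cmod a + 1))%:E)%E).
  by apply: lee_wpmul2l; [rewrite lee_fin cmod_ge0|exact: ltW].
rewrite -EFinM lte_fin mulrA ltr_pdivrMr// mulrDr mulr1 mulrC.
by rewrite ltrDl.
Qed.

Lemma approximableD u v : approximable u -> approximable v -> approximable (u + v).
Proof.
move=> au av e e0; have e2 : 0 < e / 2 by rewrite divr_gt0.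
have [x fx Nx] := au _ e2; have [y fy Ny] := av _ e2.
exists (x + y); first exact: finite_suppD.
rewrite shift_smxD opprD addrACA; apply: le_lt_trans (ND _ _) _.
by rewrite [e]splitr EFinD; exact: lteD.
Qed.

Lemma approximable0 : approximable 0.
Proof.
move=> e e0; exists 0; first exact: finite_supp0.
(* That [N] is at most 0 at the zero sequence follows from homogeneity with scalar 0. *)
rewrite shift_smx0 subrr -(scale0r 0); apply: le_lt_trans (NZ _ _) _.
by rewrite cmod0 mul0e lte_fin.
Qed.

Lemma approximable_sum (r : seq nat) (F : nat -> nat -> R[i]) :
  (forall i, approximable (F i)) -> approximable (\sum_(i <- r) F i).
Proof.
move=> aF; elim/big_ind: _ => //; first exact: approximable0.
exact: approximableD.
Qed.

Lemma approximable_limit v : (forall m, approximable (delta m)) ->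
  (forall e : R, 0 < e -> exists K,
     (N (v - \sum_(0 <= m < K) v m *: delta m)%R < e%:E)%E) ->
  approximable v.
Proof.
move=> adelta vK e e0; have e2 : 0 < e / 2 by rewrite divr_gt0.
have [K NK] := vK _ e2; set s := (\sum_(_ <= _ < _) _)%R in NK.
have : approximable s by apply: approximable_sum => i; exact: approximableZ.
move=> /(_ _ e2)[w fw Nw]; exists w => //.
rewrite -(subrKA s); apply: le_lt_trans (ND _ _) _.
by rewrite [e]splitr EFinD; exact: lteD.
Qed.

End approximation.

Lemma sum_window (V : nmodType) (x : V) k n K : (k + n <= K)%N ->
  \sum_(0 <= r < K) (if (k <= r < k + n)%N then x else 0) = x *+ n.
Proof.
move=> knK; rewrite -big_mkcond/= -(big_nat_widen _ _ _ (fun r => k <= r)%N)//.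
by rewrite -(big_nat_widenl k 0 _ predT)//= sumr_const_nat addKn.
Qed.

(** * Approximation of the unit sequences *)

Section delta_approximable.
Context (R : realType) (d : nat -> nat) (p : nat -> R) (lambda : R[i]).
Context (N : (nat -> R[i]) -> \bar R).
Hypothesis hd : is_radix d.
Hypothesis hp : forall j : nat, (1 <= j)%N -> 0 < p j <= 1.
Hypothesis ND : forall u v, (N (u + v)%R <= N u + N v)%E.
Hypothesis NZ : forall a u, (N (a *: u)%R <= (cmod a)%:E * N u)%E.
Hypothesis NS : spreading_norm N.

Local Notation q := (base_prod d).
Local Notation L := (shift_smx d p lambda).
Local Notation P := (partial_prod p).
Local Notation h := (multiplier d p lambda).
Local Notation "u =~ v" := (range_eq d p lambda u v) (at level 70).
Local Notation approx := (approximable d p lambda N).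

Definition corner_coef (k r : nat) : R[i] :=
  \prod_(k <= i < r) h i.+1 ^+ (d i.+1).-1.

Lemma corner_range_eq k r : (k <= r)%N -> corner d k =~ corner_coef k r *: corner d r.
Proof.
move/subnKC <-; elim: (r - k)%N => {r} [|j IHj].
  by rewrite addn0 /corner_coef big_geq// scale1r; exact: range_eq_refl.
rewrite addnS /corner_coef big_nat_recr ?leq_addr//= -scalerA.
apply: range_eq_trans IHj _; apply: range_eqZ.
exact: (corner_range_eqS lambda hd hp).
Qed.

Lemma cmod_corner_coef_le1 k r : (forall j, cmod (h j) <= 1) ->
  cmod (corner_coef k r) <= 1.
Proof.
move=> h1; apply: (big_ind (fun z => cmod z <= 1)); first by rewrite cmod1.
  by move=> x y x1 y1; rewrite cmodM mulr_ile1 ?cmod_ge0.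
by move=> i _; rewrite cmodX exprn_ile1 ?cmod_ge0.
Qed.

Lemma cmod_corner_coef_ge1 k r : (forall j, (k < j)%N -> 1 < cmod (h j)) ->
  1 <= cmod (corner_coef k r).
Proof.
move=> h1; rewrite /corner_coef big_nat_cond.
apply: (big_ind (fun z => 1 <= cmod z)); first by rewrite cmod1.
  move=> x y x1 y1; rewrite cmodM; exact: mulr_ege1.
move=> i /andP[/andP[ki _] _]; rewrite cmodX exprn_ege1// ltW// h1//.
Qed.

(** U_k is the average of K + 1 copies of itself. Replacing them by the congruent c_r U_r, k <= r <=
    k + K, gives entries of modulus at most 1/(K + 1) and l^1 norm at most 1. *)
Lemma corner_approximable_le1 k : (forall j, cmod (h j) <= 1) -> approx (corner d k).
Proof.
move=> h1 e e0.
have [eta eta0 small] := corner_comb_lt hd NS e0.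
have [K] := ltr_add_invr eta0; rewrite add0r => etaK.
have K0 : 0 <= K.+1%:R^-1 :> R by rewrite invr_ge0.
pose M := (k + K.+1)%N.
pose b r : R[i] := if (k <= r < M)%N then (K.+1%:R^-1)%:C * corner_coef k r else 0.
have b_le r : cmod (b r) <= (if (k <= r < M)%N then K.+1%:R^-1 else 0).
  rewrite /b; case: ifP => _; last by rewrite cmod0.
  rewrite cmodM cmod_real ger0_norm// ler_piMr//.
  exact: cmod_corner_coef_le1.
have corner_b : corner d k =~ corner_comb d b.
  rewrite -(corner_comb_finite hd (M := M)); last first.
    by move=> r Mr; rewrite /b ltnNge Mr andbF.
  pose a r : R[i] := if (k <= r < M)%N then (K.+1%:R^-1)%:C else 0.
  have -> : corner d k = \sum_(0 <= r < M) a r *: corner d k.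
    by rewrite -scaler_suml sum_window// -rmorphMn/= -mulr_natl mulfV// scale1r.
  apply: range_eq_sum => r _ _; rewrite /a /b; case: ifP => [/andP[kr _]|_].
    by rewrite -scalerA; apply: range_eqZ; exact: corner_range_eq.
  rewrite !scale0r; exact: range_eq_refl.
have [w fw wE] := corner_b; exists w => //.
have -> : corner d k - L w = corner_comb d b by rewrite -wE subKr.
apply: small => [r|K'].
  by apply: le_trans (b_le r) _; case: ifP => _; apply: ltW.
apply: le_trans (ler_sum _ (fun r _ => b_le r)) _.
(* The range is enlarged to contain the whole window, over which the sum is exactly 1. *)
apply: (@le_trans _ _ (\sum_(0 <= r < maxn K' M) if (k <= r < M)%N then K.+1%:R^-1 else 0)).
  rewrite [leRHS](big_cat_nat (n := K'))//= ?leq_maxl// lerDl.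
  by apply: sumr_ge0 => r _; case: ifP.
by rewrite sum_window ?leq_maxr// -[leLHS]mulr_natl mulfV.
Qed.

(** The numerator has modulus greater than 1 - (1 - p_(k+1)) = p_(k+1). *)
Lemma multiplier_gt1 k : 1 < cmod (h k) -> 1 < cmod (h k.+1).
Proof.
move=> hk; have /andP[p0 p1] := hp (ltn0Sn k).
have dk : (0 < d k)%N by case: k {hk p0 p1} => [|k]; [rewrite hd.1|exact: ltnW (hd.2 k.+1 isT)].
have hdk : 1 < cmod (h k ^+ d k) by rewrite cmodX exprn_egt1//; case: (d k) dk.
have -> : h k.+1 = (h k ^+ d k - (1 - p k.+1)%:C) / (p k.+1)%:C by [].
rewrite cmodM cmodV cmod_real (gtr0_norm p0) ltr_pdivlMr// mul1r.
apply: lt_le_trans (cmodB_ge _ _).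
rewrite cmod_real ger0_norm ?subr_ge0//; lra.
Qed.

Lemma multiplier_gt1_ge k j : (k <= j)%N -> 1 < cmod (h k) -> 1 < cmod (h j).
Proof.
by move/subnKC <- => hk; elim: (j - k)%N => [|i IHi]; rewrite ?addn0// addnS multiplier_gt1.
Qed.

(** These are successive differences of the P_r, which decrease and stay positive, hence
    converge. *)
Lemma fall_prob_le eta : 0 < eta -> exists M, forall r, (M <= r)%N -> fall_prob p r <= eta.
Proof.
move=> eta0; have cvgP : cvgn (partial_prod p).
  apply: nonincreasing_is_cvgn.
    apply/nonincreasing_seqP => r.
    by rewrite -subr_ge0 -fall_probE fall_prob_ge0.
  by exists 0 => _ [r _ <-]; rewrite ltW// partial_prod_gt0.
have eta2 : 0 < eta / 2 by rewrite divr_gt0.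
have /cvgrPdist_lt/(_ _ eta2)[M _ MP] := cvgP.
exists M => r Mr; have := MP r Mr; have := MP r.+1 (leqW Mr).
rewrite fall_probE /= !ltr_norml => /andP[? ?] /andP[? ?]; lra.
Qed.

(** The block relation is cut at [M]. The near part is a multiple g U_k with |g| <= P_(k+1), so it
    cannot cancel P_(k+1) h_(k+1) U_k; what is left of U_k is congruent to the far part, whose norm
    is small. *)
Lemma corner_approximable_gt1 k : (forall j, (k < j)%N -> 1 < cmod (h j)) ->
  approx (corner d k).
Proof.
move=> h1 e e0.
pose D := P k.+1 * (cmod (h k.+1) - 1).
have D0 : 0 < D by rewrite mulr_gt0 ?partial_prod_gt0// subr_gt0 h1.
(* The far part will be divided by a constant of modulus at least [D], hence the target e D. *)
have [eta eta0 small] := corner_comb_lt hd NS (mulr_gt0 e0 D0).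
have [M0 M0P] := fall_prob_le eta0; pose M := (maxn k.+1 M0).
have kM : (k < M)%N by rewrite /M; lia.
pose fall r : R[i] := (fall_prob p r)%:C.
pose near r := if (k < r < M)%N then fall r else 0.
pose far r := if (M <= r)%N then fall r else 0.
(* For r > k, U_r is congruent to U_k divided by [corner_coef k r], whose modulus is at least 1. *)
pose g := \sum_(0 <= r < M) near r / corner_coef k r.
have blockE : corner_comb d near + corner_comb d far -
    ((P k.+1)%:C * h k.+1) *: corner d k = L (lead_block d h k 0).
  have nfE : (fun r => near r + far r) = (fun r => if (k < r)%N then fall r else 0).
    apply/funext => r; rewrite /near /far; have [rk|kr] := leqP r k.
      by rewrite (leqNgt M) (leq_ltn_trans rk kM) addr0.
    by have [_|_] := ltnP r M; rewrite ?addr0 ?add0r.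
  rewrite -corner_combD nfE; apply/funext => n; rewrite corner_shift_smx//.
  set a := (fun r : nat => _).
  have -> : (corner_comb d a - ((P k.+1)%:C * h k.+1) *: corner d k) n =
    corner_comb d a n - (P k.+1)%:C * h k.+1 * corner d k n by [].
  congr (_ - _); rewrite rmorph_sum [RHS](big_nat_widenl k.+1 0)// /corner_comb.
  rewrite [LHS]big_mkcond [RHS]big_mkcond; apply: eq_bigr => r _.
  by case: (n.+1 == q r).
have near_eq : corner_comb d near =~ g *: corner d k.
  rewrite -(corner_comb_finite hd (M := M)); last first.
    by move=> r Mr; rewrite /near [(r < M)%N]ltnNge Mr andbF.
  rewrite scaler_suml; apply: range_eq_sum => r _ _.
  rewrite /near; case: ifP => [/andP[kr _]|_]; last first.
    by rewrite mul0r !scale0r; exact: range_eq_refl.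
  rewrite -scalerA; apply: range_eqZ; apply: range_eq_sym.
  have c0 : corner_coef k r != 0.
    by rewrite -cmod_eq0 gt_eqF// (lt_le_trans ltr01)// cmod_corner_coef_ge1.
  have := range_eqZ (corner_coef k r)^-1 (corner_range_eq (ltnW kr)).
  by rewrite scalerA mulVf// scale1r.
have g_le : cmod g <= P k.+1.
  apply: le_trans (cmod_sum _ _ _) _.
  apply: (@le_trans _ _ (\sum_(k.+1 <= r < M) fall_prob p r)); last first.
    by rewrite sum_fall_prob// lerBlDr lerDl ltW// partial_prod_gt0.
  rewrite [leRHS](big_nat_widenl _ 0)// [leRHS]big_mkcond/=.
  rewrite !big_nat; apply: ler_sum => r /andP[_ rM].
  rewrite /near rM andbT; case: ifP => kr; last by rewrite mul0r cmod0.
  rewrite cmodM cmodV cmod_real ger0_norm ?fall_prob_ge0// ler_piMr ?fall_prob_ge0//.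
  by rewrite invf_le1 ?cmod_corner_coef_ge1// (lt_le_trans ltr01)// cmod_corner_coef_ge1.
pose c := (P k.+1)%:C * h k.+1 - g.
have c_ge : D <= cmod c.
  apply: le_trans (cmodB_ge _ _).
  rewrite cmodM cmod_real gtr0_norm ?partial_prod_gt0// /D mulrBr mulr1.
  by rewrite lerB.
have c0 : c != 0 by rewrite -cmod_eq0 gt_eqF// (lt_le_trans D0).
have far_eq : corner_comb d far =~ c *: corner d k.
  have [w fw wE] := near_eq; exists (lead_block d h k 0 - w).
    by apply: finite_suppB => //; exact: finite_supp_block.
  rewrite shift_smxB -blockE -wE /c scalerBl.
  by rewrite !opprB !addrA; apply/eqP; rewrite -subr_eq0; apply/eqP; ring.
have [w fw wE] := range_eq_sym (range_eqZ c^-1 far_eq).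
exists w => //.
rewrite -wE scalerA mulVf// scale1r subKr; apply: le_lt_trans (NZ _ _) _; rewrite cmodV.
have cc0 : 0 < cmod c by exact: lt_le_trans c_ge.
apply: (@lt_le_trans _ _ ((cmod c)^-1%:E * (e * D)%:E)%E).
  rewrite lte_pmul2l ?lte_fin ?invr_gt0//; apply: small => [r|K].
    rewrite /far; case: leqP => Mr; last by rewrite cmod0 ltW.
    rewrite cmod_real ger0_norm ?fall_prob_ge0//; apply: M0P.
    by move: Mr; rewrite /M; lia.
  apply: (@le_trans _ _ (\sum_(0 <= r < K) fall_prob p r)).
    apply: ler_sum => r _; rewrite /far; case: ifP => _; last by rewrite cmod0 fall_prob_ge0.
    by rewrite cmod_real ger0_norm ?fall_prob_ge0.
  by rewrite sum_fall_prob// partial_prod0 lerBlDr lerDl ltW// partial_prod_gt0.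
by rewrite -EFinM lee_fin mulrC ler_pdivrMr// ler_pM2l.
Qed.

Lemma delta_approximable m : approx (delta m).
Proof.
have [h1|] := pselect (forall j, cmod (h j) <= 1).
  have [c mE] := delta_range_eq_corner lambda hd hp (base_prod_gt m hd).
  apply: approximable_range_eq mE _; apply: approximableZ => //.
  exact: corner_approximable_le1.
move=> /existsNP[k /negP]; rewrite -ltNge => hk.
(* This level is large enough for its block to contain [m], and is at least [k], so that all later
   multipliers have modulus greater than 1. *)
have mK : (m < q (maxn m k))%N.
  by apply: leq_trans (base_prod_gt (maxn m k) hd); rewrite ltnS leq_maxl.
have [c mE] := delta_range_eq_corner lambda hd hp mK.
apply: approximable_range_eq mE _; apply: approximableZ => //.
apply: corner_approximable_gt1 => j kj; apply: multiplier_gt1_ge hk.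
by move: kj; lia.
Qed.

End delta_approximable.

(** * The sequence spaces *)

Definition truncation (R : realType) (v : nat -> R[i]) (K : nat) : nat -> R[i] :=
  \sum_(0 <= m < K) v m *: delta m.

Lemma truncation_tail (R : realType) (v : nat -> R[i]) K n :
  (v - truncation v K) n = if (n < K)%N then 0 else v n.
Proof.
have -> : (v - truncation v K) n = v n - truncation v K n by [].
rewrite /truncation fct_sumE.
have -> : \sum_(0 <= m < K) (v m *: delta m) n = \sum_(0 <= m < K | m == n) v m.
  rewrite [RHS]big_mkcond; apply: eq_bigr => m _.
  have -> : (v m *: delta m) n = v m * (n == m)%:R by [].
  by rewrite eq_sym; case: (m == n); rewrite ?mulr1 ?mulr0.
by rewrite big_nat1_eq /=; case: ifP; rewrite ?subrr ?subr0.
Qed.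

(** The common argument for c_0 and l^alpha. The condition on truncations fails in c, where the
    limit has to be split off first. *)
Lemma shift_smx_dense (R : realType) (d : nat -> nat) (p : nat -> R) (lambda : R[i])
    (Omega : set (nat -> R[i])) (N : (nat -> R[i]) -> \bar R) :
  is_radix d -> (forall j : nat, (1 <= j)%N -> 0 < p j <= 1) ->
  (forall u v, (N (u + v)%R <= N u + N v)%E) ->
  (forall a u, (N (a *: u)%R <= (cmod a)%:E * N u)%E) ->
  spreading_norm N ->
  (forall v, Omega v -> forall e : R, 0 < e ->
     exists K, (N (v - truncation v K)%R < e%:E)%E) ->
  forall v, Omega v -> forall e : R, 0 < e ->
    exists2 w, finite_supp w & (N (v - shift_smx d p lambda w)%R < e%:E)%E.
Proof.
move=> hd hp ND NZ NS tails v Ov.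
apply: (@approximable_limit R d p lambda N) => //; last exact: tails.
exact: delta_approximable.
Qed.

Lemma shift_smx_cst (R : realType) (d : nat -> nat) (p : nat -> R) (lambda : R[i]) :
  is_radix d -> shift_smx d p lambda (cst 1) = cst (1 - lambda).
Proof.
move=> hd; apply/funext => n; rewrite /shift_smx /shift_op /smx_op mulr1.
under eq_bigr do rewrite mulr1.
by rewrite -(rmorph_sum (real_complex R)) smx_row_sum// rmorph1.
Qed.

Section sup_norm.
Context (R : realType).
Implicit Types u v w : nat -> R[i].

Lemma sup_norm_le w (c : \bar R) :
  (forall n, ((cmod (w n))%:E <= c)%E) -> (sup_norm w <= c)%E.
Proof. by move=> wc; apply: ge_ereal_sup => _ [n _ <-]. Qed.

Lemma le_sup_norm w n : ((cmod (w n))%:E <= sup_norm w)%E.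
Proof. by apply: ereal_sup_ubound; exists n. Qed.

Lemma sup_normD u v : (sup_norm (u + v)%R <= sup_norm u + sup_norm v)%E.
Proof.
apply: sup_norm_le => n; apply: (@le_trans _ _ ((cmod (u n))%:E + (cmod (v n))%:E)%E).
  by rewrite -EFinD lee_fin cmodD.
by apply: leeD; exact: le_sup_norm.
Qed.

Lemma sup_normZ a u : (sup_norm (a *: u)%R <= (cmod a)%:E * sup_norm u)%E.
Proof.
apply: sup_norm_le => n.
have -> : (a *: u) n = a * u n by [].
rewrite cmodM EFinM; apply: lee_wpmul2l; last exact: le_sup_norm.
by rewrite lee_fin cmod_ge0.
Qed.

Lemma sup_norm_spreading : spreading_norm (@sup_norm R).
Proof.
(* Entrywise bounds give only a non-strict bound on the supremum, hence the half. *)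
move=> e e0; exists (e / 2); first by rewrite divr_gt0.
move=> x xe _; apply: (@le_lt_trans _ _ (e / 2)%:E); first exact: sup_norm_le.
by rewrite lte_fin ltr_pdivrMr// ltr_pMr// ltr1n.
Qed.

Lemma c0_spaceP w : c0_space R w <->
  forall e : R, 0 < e -> exists K, forall n, (K <= n)%N -> cmod (w n) < e.
Proof.
split=> [/cvgr0Pnorm_lt w0 e e0|w0].
  have [|K _ KP] := w0 e%:C; first by rewrite ltcR.
  by exists K => n /KP /=; rewrite normr_cmod ltcR.
apply/cvgr0Pnorm_lt => e e0.
(* The radii of the topology on [R[i]^o] are positive elements of [R[i]], and these are real. *)
have eE : e = (complex.Re e)%:C by rewrite RRe_real// gtr0_real.
have [|K KP] := w0 (complex.Re e); first by rewrite -ltcR -eE.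
by exists K => // n /KP /=; rewrite -ltcR -eE.
Qed.

Lemma finite_supp_c0 w : finite_supp w -> c0_space R w.
Proof.
by move=> [K wK]; apply/c0_spaceP => e e0; exists K => n /wK ->; rewrite cmod0.
Qed.

Lemma c0_tails v : c0_space R v -> forall e : R, 0 < e ->
  exists K, (sup_norm (v - truncation v K)%R < e%:E)%E.
Proof.
move=> /c0_spaceP v0 e e0; have [|K KP] := v0 (e / 2); first by rewrite divr_gt0.
exists K; apply: (@le_lt_trans _ _ (e / 2)%:E); last first.
  by rewrite lte_fin ltr_pdivrMr// ltr_pMr// ltr1n.
apply: sup_norm_le => n; rewrite truncation_tail lee_fin.
by case: ltnP => [_|/KP/ltW//]; rewrite cmod0 divr_ge0// ltW.
Qed.

End sup_norm.

Section lp_norm.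
Context (R : realType) (alpha : R).
Hypothesis alpha1 : 1 < alpha.
Implicit Types u v w : nat -> R[i].

Let alpha0 : 0 < alpha. Proof. exact: lt_trans alpha1. Qed.

Lemma lp_normE w :
  lp_norm alpha w = ((\sum_(n <oo) (cmod (w n) `^ alpha)%:E) `^ alpha^-1)%E.
Proof.
rewrite /lp_norm Lnorm_counting//; congr (_ `^ _)%E.
by apply: eq_eseriesr => n _; rewrite abse_EFin ger0_norm ?cmod_ge0.
Qed.

Lemma lp_norm_le w (c : R) : 0 <= c ->
  (forall K, \sum_(0 <= n < K) cmod (w n) `^ alpha <= c `^ alpha) ->
  (lp_norm alpha w <= c%:E)%E.
Proof.
move=> c0 wc; rewrite lp_normE.
have le : (\sum_(n <oo) (cmod (w n) `^ alpha)%:E <= (c `^ alpha)%:E)%E.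
  apply: lime_le; first by apply: is_cvg_nneseries => n _ _; rewrite lee_fin powR_ge0.
  by apply: nearW => K; rewrite sumEFin lee_fin.
apply: (@le_trans _ _ ((c `^ alpha)%:E `^ alpha^-1)%E).
  apply: gt0_ler_poweR => //; first by rewrite invr_ge0 ltW.
    by rewrite in_itv/= leey andbT; apply: nneseries_ge0 => n _ _; rewrite lee_fin powR_ge0.
  by rewrite in_itv/= leey andbT lee_fin powR_ge0.
by rewrite poweR_EFin -powRrM mulfV ?gt_eqF// powRr1.
Qed.

Lemma le_lp_norm u v : (forall n, cmod (u n) <= cmod (v n)) ->
  (lp_norm alpha u <= lp_norm alpha v)%E.
Proof.
move=> uv; rewrite !lp_normE.
have s0 w : (\sum_(n <oo) (cmod (w n) `^ alpha)%:E)%E \in `[0%R%:E, +oo%E].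
  rewrite in_itv/= leey andbT.
  by apply: nneseries_ge0 => n _ _; rewrite lee_fin powR_ge0.
apply: gt0_ler_poweR => //; first by rewrite invr_ge0 ltW.
apply: lee_nneseries => n _; first by rewrite lee_fin powR_ge0.
by rewrite lee_fin ge0_ler_powR// ?nnegrE ?cmod_ge0// ltW.
Qed.

Lemma lp_normD u v : (lp_norm alpha (u + v)%R <= lp_norm alpha u + lp_norm alpha v)%E.
Proof.
(* A dominating sequence, through which the real Minkowski inequality for the moduli applies. *)
pose s n := (cmod (u n) + cmod (v n))%:C.
have sE n : cmod (s n) = cmod (u n) + cmod (v n).
  by rewrite cmod_real ger0_norm// addr_ge0 ?cmod_ge0.
apply: (@le_trans _ _ (lp_norm alpha s)).
  by apply: le_lp_norm => n; rewrite sE cmodD.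
have -> : lp_norm alpha s =
    Lnorm counting alpha%:E (EFin \o ((@cmod R \o u) \+ (@cmod R \o v))).
  by rewrite /lp_norm; congr Lnorm; apply/funext => n; rewrite sE.
by apply: minkowski_EFin => //; exact: ltW.
Qed.

Lemma lp_normZ a u : (lp_norm alpha (a *: u)%R <= (cmod a)%:E * lp_norm alpha u)%E.
Proof.
rewrite !lp_normE.
have pos n : (0 <= (cmod (u n) `^ alpha)%:E)%E by rewrite lee_fin powR_ge0.
rewrite (@eq_eseriesr _ _
  (fun n => (cmod a `^ alpha)%:E * (cmod (u n) `^ alpha)%:E)%E); last first.
  move=> n _; have -> : (a *: u) n = a * u n by [].
  by rewrite cmodM powRM ?cmod_ge0// EFinM.
rewrite nneseriesZl// poweRM ?lee_fin ?powR_ge0//; last by apply: nneseries_ge0.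
by rewrite poweR_EFin -powRrM mulfV ?gt_eqF// powRr1 ?cmod_ge0.
Qed.

(** Since alpha - 1 > 0, |x_n|^alpha <= eta^(alpha-1) |x_n|. Summing over [n] bounds the total by
    eta^(alpha-1), and [eta] is chosen to make this (e/2)^alpha. *)
Lemma lp_norm_spreading : spreading_norm (lp_norm alpha).
Proof.
move=> e e0; have e2 : 0 < e / 2 by rewrite divr_gt0.
have a1 : alpha - 1 != 0 by rewrite gt_eqF// subr_gt0.
pose eta := ((e / 2) `^ alpha) `^ (alpha - 1)^-1.
have etaE : eta `^ (alpha - 1) = (e / 2) `^ alpha.
  by rewrite -powRrM mulVf// powRr1// powR_ge0.
exists eta; first by rewrite !powR_gt0.
move=> x xeta x1; apply: (@le_lt_trans _ _ (e / 2)%:E); last first.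
  by rewrite lte_fin ltr_pdivrMr// ltr_pMr// ltr1n.
apply: lp_norm_le => [|K]; first exact: ltW.
apply: (@le_trans _ _ (\sum_(0 <= n < K) (e / 2) `^ alpha * cmod (x n))).
  apply: ler_sum => n _; rewrite -[X in _ `^ X](subrK 1) powRD; last first.
    by rewrite subrK gt_eqF.
  rewrite powRr1 ?cmod_ge0// ler_wpM2r ?cmod_ge0// -etaE.
  by rewrite ge0_ler_powR// ?nnegrE ?cmod_ge0 ?powR_ge0// subr_ge0 ltW.
by rewrite -mulr_sumr ler_piMr ?powR_ge0.
Qed.

Lemma finite_supp_lp w : finite_supp w -> lp_space alpha w.
Proof.
move=> [M wM]; pose S := \sum_(0 <= n < M) cmod (w n) `^ alpha.
have S0 : 0 <= S by apply: sumr_ge0 => n _; exact: powR_ge0.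
apply: (@le_lt_trans _ _ (S `^ alpha^-1)%:E); last exact: ltry.
apply: lp_norm_le => [|K]; first exact: powR_ge0.
rewrite -powRrM mulVf ?gt_eqF// powRr1//.
apply: (@le_trans _ _ (\sum_(0 <= n < maxn K M) cmod (w n) `^ alpha)).
  rewrite [leRHS](big_cat_nat (n := K))//= ?leq_maxl// lerDl.
  by apply: sumr_ge0 => n _; exact: powR_ge0.
rewrite (big_cat_nat (n := M))//= ?leq_maxr// [X in _ + X <= _]big_nat.
rewrite [X in _ + X <= _]big1 ?addr0// => n /andP[/wM-> _].
by rewrite cmod0 powR0// gt_eqF.
Qed.

Lemma lp_tails v : lp_space alpha v -> forall e : R, 0 < e ->
  exists K, (lp_norm alpha (v - truncation v K)%R < e%:E)%E.
Proof.
move=> vlp e e0; have e2 : 0 < e / 2 by rewrite divr_gt0.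
have pos n : (0 <= (cmod (v n) `^ alpha)%:E)%E by rewrite lee_fin powR_ge0.
have fin : (\sum_(n <oo) (cmod (v n) `^ alpha)%:E < +oo)%E.
  by move: vlp; rewrite /lp_space/= lp_normE; apply: lty_poweRy; rewrite invr_neq0// gt_eqF.
have ea0 : (0 < ((e / 2) `^ alpha)%:E)%E by rewrite lte_fin powR_gt0.
have tail0 := nneseries_tail_cvg fin (fun n _ => pos n).
have [K _ /(_ K (leqnn K))/= /ltW tailK] := tail0 _ (open_ereal_lt' ea0).
exists K; apply: (@le_lt_trans _ _ (e / 2)%:E); last first.
  by rewrite lte_fin ltr_pdivrMr// ltr_pMr// ltr1n.
apply: lp_norm_le => [|M]; first exact: ltW.
rewrite -lee_fin; apply: le_trans tailK.
apply: le_trans (nneseries_lim_ge (maxn K M) (fun n _ _ => pos n)).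
rewrite sumEFin lee_fin.
apply: (@le_trans _ _ (\sum_(0 <= n < maxn K M) cmod ((v - truncation v K) n) `^ alpha)).
  rewrite [leRHS](big_cat_nat (n := M))//= ?leq_maxr// lerDl.
  by apply: sumr_ge0 => n _; exact: powR_ge0.
rewrite (big_cat_nat (n := K))//= ?leq_maxl// big_nat big1 ?add0r => [|n /andP[_ nK]].
  rewrite !big_nat; apply: ler_sum => n /andP[Kn _].
  by rewrite truncation_tail ltnNge Kn.
by rewrite truncation_tail nK cmod0 powR0// gt_eqF.
Qed.

End lp_norm.

Theorem proposition4p3 (R : realType) (d : nat -> nat) (p : nat -> R)
    (hd : is_radix d) (hp : forall j : nat, (1 <= j)%N -> 0 < p j <= 1) :
  [/\ residual_spectrum (c0_space R) (@sup_norm R) (smx_op d p) = set0,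
      residual_spectrum (c_space R) (@sup_norm R) (smx_op d p) = set0
    & forall alpha : R, 1 < alpha ->
        residual_spectrum (lp_space alpha) (lp_norm alpha) (smx_op d p) = set0].
Proof.
have dense0 lambda := @shift_smx_dense R d p lambda (c0_space R) (@sup_norm R) hd hp
  (@sup_normD R) (@sup_normZ R) (@sup_norm_spreading R) (@c0_tails R).
(* In each space the range is shown to be dense, except on c for lambda = 1, where injectivity is
   contradicted. *)
split=> [||alpha alpha1]; apply/seteqP; split=> // lambda [inj]; apply.
- move=> v v0 e e0; have [w fw Nw] := dense0 lambda v v0 e e0.
  by exists (shift_smx d p lambda w) => //; exists w => //; exact: finite_supp_c0.
- have [l1|l1] := eqVneq lambda 1.
    have const_c (a : R[i]) : c_space R (cst a) by exact: is_cvg_cst.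
    suff : (cst 1 : nat -> R[i]) = cst 0.
      by move/(congr1 (@^~ 0%N)) => /= /eqP; rewrite oner_eq0.
    apply: inj; rewrite ?inE//.
    have := shift_smx_cst p lambda hd; rewrite /shift_smx => ->.
    have := shift_smx0 d p lambda; rewrite /shift_smx => ->.
    by rewrite l1 subrr.
  (* For lambda different from 1, the null sequence v - l is approximated as in c_0, and the
     constant [l] is the exact image of the constant l / (1 - lambda). *)
  move=> v /cvg_ex[l vl] e e0.
  have v0 : c0_space R (v - cst l).
    have := cvgB vl (cvg_cst (l : R[i]^o)).
    by rewrite subrr; apply.
  have [w fw Nw] := dense0 lambda _ v0 e e0.
  have l0 : 1 - lambda != 0 by rewrite subr_eq0 eq_sym.
  exists (shift_smx d p lambda (w + (l / (1 - lambda)) *: cst 1)).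
    exists (w + (l / (1 - lambda)) *: cst 1) => //.
    have w0 := finite_supp_c0 fw.
    apply: is_cvgD; first by apply/cvg_ex; exists 0.
    by apply: is_cvgZr; exact: is_cvg_cst.
  rewrite shift_smxD shift_smxZ shift_smx_cst//.
  have -> : (l / (1 - lambda)) *: cst (1 - lambda) = (cst l : nat -> R[i]).
    by apply/funext => n; rewrite /cst; apply: divfK.
  suff : (sup_norm (v - (shift_smx d p lambda w + cst l))%R < e%:E)%E by [].
  by rewrite opprD addrA addrAC.
- move=> v v0 e e0.
  have [w fw Nw] := @shift_smx_dense R d p lambda (lp_space alpha) (lp_norm alpha) hd hp
    (lp_normD alpha1) (lp_normZ alpha1) (lp_norm_spreading alpha1) (lp_tails alpha1) v v0 e e0.
  by exists (shift_smx d p lambda w) => //; exists w => //; exact: finite_supp_lp.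
Qed.
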